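(* Let $p$ be a prime, let $\mathbb{F}$ be an algebraic closure of $\mathbb{F}_p$, and let $G=GL_2(\mathbb{F}_p)$ and $N=SL_2(\mathbb{F}_p)$. For all $0\le k\le p-1$ and $0\le r\le p-2$, $$\mathrm{Res}^G_N(\mathrm{Ind}^G_N Pol_k)\cong (p-1)\,Pol_k,$$ $$\mathrm{Res}^G_N Pol_k(r)\cong Pol_k,$$ and $$\mathrm{Ind}^G_N Pol_k\cong\bigoplus_{r=0}^{p-2}Pol_k(r).$$
   Context: $Pol_k$ is the $\mathbb{F}$-vector space of homogeneous polynomials of degree $k$ in two variables $x,y$ over $\mathbb{F}$, a representation of $N$ via $\rho_{Pol_k}(g)\cdot P(x,y)=P(ax+cy,bx+dy)$ for $g=\begin{pmatrix} a&b\\ c&d\end{pmatrix}\in N$. For $r\in\mathbb{Z}$, $Pol_k(r)$ is the same space with $g=\begin{pmatrix} a&b\\ c&d\end{pmatrix}\in G$ acting by $\rho_{Pol_k(r)}(g)\cdot P(x,y)=\det(g)^r\,P(ax+cy,bx+dy)$. For a representation $\sigma$ of $N$ on $V_\sigma$, $\mathrm{Ind}^G_N V_\sigma=\{f:G\to V_\sigma\mid f(gn)=\sigma(n^{-1})f(g)\ \forall n\in N,g\in G\}$ with $G$ acting by left translation, $(g\cdot f)(x)=f(g^{-1}x)$; $\mathrm{Res}^G_N$ is restriction to $N$; $m\rho$ denotes the direct sum of $m$ copies of $\rho$. *)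

(* Defs.v *)
From HB Require Import structures.
From mathcomp Require Import all_boot all_fingroup all_algebra.
From mathcomp Require Import mpoly.

Set Implicit Arguments.
Unset Strict Implicit.
Unset Printing Implicit Defensive.

Import GRing.Theory.
Local Open Scope ring_scope.

(* A linear representation on the F-vector space V of a subgroup H of a finite
   group.  As for mx_representation, the action is given on the whole ambient
   group but only its values on H are constrained or used. *)
Record rep (F : fieldType) (gT : finGroupType) (H : {group gT})
    (V : lmodType F) := Rep {
  rep_act :> gT -> {linear V -> V};
  rep1 : forall v, rep_act 1%g v = v;
  repM : {in H &, forall g h v, rep_act (g * h)%g v = rep_act g (rep_act h v)}
}.

Definition rep_iso (F : fieldType) (gT : finGroupType) (H : {group gT})
    (V W : lmodType F) (rho : rep H V) (sigma : rep H W) : Prop :=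
  exists2 phi : {linear V -> W}, bijective phi &
    {in H, forall g v, phi (rho g v) = sigma g (phi v)}.

Section Restriction.
Variables (F : fieldType) (gT : finGroupType) (H K : {group gT}).
Variables (V : lmodType F) (sHK : H \subset K) (rho : rep K V).

Fact res_repM :
  {in H &, forall g h v, rho (g * h)%g v = rho g (rho h v)}.
Proof. by move=> g h /(subsetP sHK) gK /(subsetP sHK) hK; exact: repM. Qed.

Definition Res : rep H V := Rep (rep1 rho) res_repM.

End Restriction.

(* Since all the summands used below live on the same space V, the finite
   direct sum of a family rho_i is taken on V^I, acting componentwise. *)
Section DirectSum.
Variables (F : fieldType) (gT : finGroupType) (H : {group gT}).
Variables (V : lmodType F) (I : finType) (rho : I -> rep H V).

Definition dsum_act (g : gT) (f : {ffun I -> V}) : {ffun I -> V} :=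
  [ffun i => rho i g (f i)].

Fact dsum_act_linear g : linear (dsum_act g).
Proof. by move=> a u v; apply/ffunP=> i; rewrite !ffunE linearP. Qed.

HB.instance Definition _ g :=
  GRing.isLinear.Build F {ffun I -> V} {ffun I -> V} _ (dsum_act g)
    (dsum_act_linear g).

Fact dsum_act1 f : dsum_act 1%g f = f.
Proof. by apply/ffunP=> i; rewrite ffunE rep1. Qed.

Fact dsum_actM :
  {in H &, forall g h f, dsum_act (g * h)%g f = dsum_act g (dsum_act h f)}.
Proof. by move=> g h gH hH f; apply/ffunP=> i; rewrite !ffunE repM. Qed.

Definition dsum : rep H {ffun I -> V} :=
  @Rep F gT H {ffun I -> V} (fun g => dsum_act g) dsum_act1 dsum_actM.

End DirectSum.

Definition copies (F : fieldType) (gT : finGroupType) (H : {group gT})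
    (V : lmodType F) (m : nat) (rho : rep H V) : rep H {ffun 'I_m -> V} :=
  dsum (fun _ : 'I_m => rho).

(* Induction from a subgroup N to the whole ambient group gT. *)
Section Induction.
Variables (F : fieldType) (gT : finGroupType) (N : {group gT}).
Variables (V : lmodType F) (sigma : rep N V).

Definition ind_pred : {pred {ffun gT -> V}} :=
  [pred f : {ffun gT -> V} |
    [forall n in N, forall g, f (g * n)%g == sigma n^-1%g (f g)]].

Lemma ind_predP (f : {ffun gT -> V}) :
  reflect {in N, forall n g, f (g * n)%g = sigma n^-1%g (f g)}
          (f \in ind_pred).
Proof.
apply: (iffP forall_inP) => [fP n nN g | fP n nN].
  by apply/eqP; have /forallP := fP n nN; apply.
by apply/forallP=> g; rewrite fP.
Qed.

Fact ind_pred_submod : submod_closed ind_pred.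
Proof.
split=> [|a u v /ind_predP uP /ind_predP vP]; apply/ind_predP=> n nN g.
  by rewrite !ffunE linear0.
by rewrite !ffunE uP // vP // linearP.
Qed.

HB.instance Definition _ :=
  GRing.isSubmodClosed.Build F {ffun gT -> V} ind_pred ind_pred_submod.

Record ind_space :=
  IndSpace { ind_fun :> {ffun gT -> V}; _ : ind_fun \in ind_pred }.

HB.instance Definition _ := [isSub for ind_fun].
HB.instance Definition _ := [Choice of ind_space by <:].
HB.instance Definition _ := [SubChoice_isSubLmodule of ind_space by <:].

Definition ltrans (g : gT) (f : {ffun gT -> V}) : {ffun gT -> V} :=
  [ffun x => f (g^-1 * x)%g].

Fact ltrans_ind g (f : ind_space) : ltrans g f \in ind_pred.
Proof.
by apply/ind_predP=> n nN x; rewrite !ffunE mulgA (ind_predP _ (valP f)).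
Qed.

Definition ind_act (g : gT) (f : ind_space) : ind_space :=
  IndSpace (ltrans_ind g f).

Fact ind_act_linear g : linear (ind_act g).
Proof. by move=> a u v; apply/val_inj/ffunP=> x; rewrite /= !ffunE. Qed.

HB.instance Definition _ g :=
  GRing.isLinear.Build F ind_space ind_space _ (ind_act g) (ind_act_linear g).

Fact ind_act1 f : ind_act 1%g f = f.
Proof. by apply/val_inj/ffunP=> x; rewrite !ffunE invg1 mul1g. Qed.

Fact ind_actM :
  {in [set: gT]%G &,
    forall g h f, ind_act (g * h)%g f = ind_act g (ind_act h f)}.
Proof.
by move=> g h _ _ f; apply/val_inj/ffunP=> x; rewrite !ffunE invMg mulgA.
Qed.

Definition Ind : rep [set: gT]%G ind_space :=
  @Rep F gT [set: gT]%G ind_space (fun g => ind_act g) ind_act1 ind_actM.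

End Induction.

Definition SL2_set (p : nat) : {set {'GL_2(p)}} :=
  [set g | \det (GLval g) == 1].

Fact SL2_group_set p : group_set (SL2_set p).
Proof.
apply/group_setP; split=> [|g h]; rewrite !inE ?det1 // => /eqP dg /eqP dh.
by rewrite GL_ME det_mulmx dg dh mulr1.
Qed.

Canonical SL2 (p : nat) : {group {'GL_2(p)}} := Group (SL2_group_set p).

(* iota is the embedding of F_p in the coefficient field F; the variables x
   and y are 'X_0 and 'X_1. *)
Section PolynomialRepresentations.
Variables (p : nat) (F : fieldType) (iota : {rmorphism 'F_p -> F}).
Implicit Types g h : {'GL_2(p)}.

(* The pair (a x + c y, b x + d y) for g = (a b; c d). *)
Definition subst_of g : 2.-tuple {mpoly F[2]} :=
  [tuple \sum_(i < 2) iota (GLval g i j) *: 'X_i | j < 2].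

Fact tnth_subst_homog g j : tnth (subst_of g) j \is 1.-homog.
Proof.
rewrite tnth_mktuple; apply: rpred_sum => i _; apply: rpredZ.
by rewrite dhomogX /= mdeg1.
Qed.

Fact subst_ofM g h j :
  tnth (subst_of h) j \mPo subst_of g = tnth (subst_of (g * h)%g) j.
Proof.
rewrite !tnth_mktuple raddf_sum /=.
under eq_bigr => i _ do
  rewrite linearZ /= comp_mpolyXU -tnth_nth tnth_mktuple scaler_sumr.
rewrite exchange_big; apply: eq_bigr => i _ /=.
rewrite mxE rmorph_sum scaler_suml; apply: eq_bigr => l _.
by rewrite scalerA rmorphM mulrC.
Qed.

Fact subst_homog g (k : nat) (P : dhomog 2 F k) :
  (mpoly_of_dhomog P \mPo subst_of g) \is k.-homog.
Proof.
rewrite comp_mpolyEX big_seq; apply: rpred_sum => m mP; apply: rpredZ.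
rewrite comp_mpolyX !big_ord_recl big_ord0 mulr1.
have <- : mdeg m = k by exact: (dhomog_mf (valP P) mP).
rewrite mdegE !big_ord_recl big_ord0 addn0.
apply: dhomogM; rewrite -[X in X.-homog]mul1n; apply: dhomogMn;
  exact: tnth_subst_homog.
Qed.

Definition pol_subst k g (P : dhomog 2 F k) : dhomog 2 F k :=
  DHomog (subst_homog g P).

Fact pol_subst_linear k g : linear (@pol_subst k g).
Proof. by move=> a P Q; apply/val_inj; rewrite /= linearP. Qed.

HB.instance Definition _ k g :=
  GRing.isLinear.Build F (dhomog 2 F k) (dhomog 2 F k) _
    (@pol_subst k g) (@pol_subst_linear k g).

Fact pol_subst1 k P : @pol_subst k 1%g P = P.
Proof.
apply/val_inj; rewrite /= -[RHS]comp_mpoly_id; congr (_ \mPo _).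
apply: eq_from_tnth => j.
rewrite !tnth_mktuple (bigD1 j) //= big1 => [|i /negPf ij].
  by rewrite mxE eqxx rmorph1 scale1r addr0.
by rewrite mxE ij rmorph0 scale0r.
Qed.

Fact pol_substM k g h P :
  @pol_subst k (g * h)%g P = pol_subst g (pol_subst h P).
Proof.
apply/val_inj; rewrite /= (comp_mpolyEX _ (subst_of h)) raddf_sum comp_mpolyEX.
apply: eq_bigr => m _ /=; rewrite linearZ /= !comp_mpolyX rmorph_prod /=.
by congr (_ *: _); apply: eq_bigr => i _; rewrite rmorphXn /= subst_ofM.
Qed.

Definition Pol (k : nat) : rep (SL2 p) (dhomog 2 F k) :=
  @Rep F _ (SL2 p) (dhomog 2 F k) (fun g => @pol_subst k g)
    (@pol_subst1 k) (fun g h _ _ => @pol_substM k g h).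

Definition pold_act k (r : int) g (P : dhomog 2 F k) : dhomog 2 F k :=
  iota (\det (GLval g)) ^ r *: pol_subst g P.

Fact pold_act_linear k r g : linear (@pold_act k r g).
Proof.
by move=> a P Q; rewrite /pold_act linearP scalerDr !scalerA mulrC.
Qed.

HB.instance Definition _ k r g :=
  GRing.isLinear.Build F (dhomog 2 F k) (dhomog 2 F k) _
    (@pold_act k r g) (@pold_act_linear k r g).

Fact pold_act1 k r P : @pold_act k r 1%g P = P.
Proof. by rewrite /pold_act det1 rmorph1 exp1rz scale1r pol_subst1. Qed.

Fact pold_actM k r g h P :
  @pold_act k r (g * h)%g P = pold_act r g (pold_act r h P).
Proof.
rewrite /pold_act GL_ME det_mulmx rmorphM expfzMl linearZ /= scalerA.
by rewrite pol_substM.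
Qed.

Definition PolDet (k : nat) (r : int) :
    rep [set: {'GL_2(p)}]%G (dhomog 2 F k) :=
  @Rep F _ [set: {'GL_2(p)}]%G (dhomog 2 F k) (fun g => @pold_act k r g)
    (@pold_act1 k r) (fun g h _ _ => @pold_actM k r g h).

End PolynomialRepresentations.

(* Main.v *)
From HB Require Import structures.
Require Import Defs.
From mathcomp Require Import all_boot all_fingroup all_algebra.
From mathcomp Require Import mpoly.

Set Implicit Arguments.
Unset Strict Implicit.
Unset Printing Implicit Defensive.

Import GRing.Theory.
Local Open Scope ring_scope.

(** Let a representation rho of G restrict to sigma on N, the kernel of a
    character chi with values in F.  For f in Ind sigma the function
    g |-> rho g (f g) only depends on chi g, and the discrete Fourier transform
    v_s = \sum_t t^s *: (its value where chi = t), over the values t of chi,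
    turns left translation into rho twisted by chi^s.  This transform is
    invertible because its matrix is a Vandermonde matrix with distinct nodes. *)

Lemma Vandermonde_unitmx (F : fieldType) (m : nat) (a : 'rV[F]_m) :
  injective (a 0) -> Vandermonde m a \in unitmx.
Proof.
move=> a_inj; rewrite unitmxE det_Vandermonde unitfE.
apply/prodf_neq0 => i _; apply/prodf_neq0 => j ij.
by rewrite subr_eq0 (inj_eq a_inj) -val_eqE /= gtn_eqF.
Qed.

(** * Fourier transform on induction from the kernel of a character *)

Section InductionFromKernel.
Variables (F : fieldType) (gT : finGroupType) (N : {group gT}).
Variables (V : lmodType F) (rho : rep [set: gT]%G V) (sigma : rep N V).
Hypothesis sigmaE : {in N, forall n v, sigma n v = rho n v}.
Variables (chi : gT -> F).
Hypotheses (chiM : {morph chi : g h / (g * h)%g >-> g * h}).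
Hypothesis chi_ker : forall g, (g \in N) = (chi g == 1).
(* d lists a transversal of N, cls the position in it of the class of g. *)
Variables (m : nat) (d : 'I_m -> gT) (cls : gT -> 'I_m).
Hypotheses (clsK : forall g, chi (d (cls g)) = chi g).
Hypothesis (chid_inj : injective (chi \o d)).
Variable tau : 'I_m -> rep [set: gT]%G V.
Hypothesis tauE : forall s g v, tau s g v = chi g ^+ s *: rho g v.

Let rhoM g h v : rho (g * h)%g v = rho g (rho h v).
Proof. by rewrite repM ?inE. Qed.

Let rhoK g : cancel (rho g) (rho g^-1%g).
Proof. by move=> v; rewrite -rhoM mulVg rep1. Qed.

Let rhoVK g : cancel (rho g^-1%g) (rho g).
Proof. by move=> v; rewrite -rhoM mulgV rep1. Qed.

Let chi1 : chi 1%g = 1.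
Proof. by apply/eqP; rewrite -chi_ker group1. Qed.

Let chi_neq0 g : chi g != 0.
Proof.
apply/eqP => g0; have /eqP := chi1.
by rewrite -(mulgV g) chiM g0 mul0r eq_sym oner_eq0.
Qed.

Let clsP g h : chi g = chi h -> cls g = cls h.
Proof. by move=> gh; apply: chid_inj; rewrite /= !clsK. Qed.

Let cls_d i : cls (d i) = i.
Proof. by apply: chid_inj; rewrite /= clsK. Qed.

Definition fourier_mx : 'M[F]_m := Vandermonde m (\row_i chi (d i)).

Lemma fourier_mxE s i : fourier_mx s i = chi (d i) ^+ s.
Proof. by rewrite !mxE. Qed.

Lemma fourier_mx_unit : fourier_mx \in unitmx.
Proof. by apply: Vandermonde_unitmx => i j; rewrite !mxE; apply: chid_inj. Qed.

Definition untwist (f : ind_space sigma) (g : gT) : V := rho g (f g).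

(** Here [h = g * n] with [n] in the kernel [N]; equivariance of [f] produces [rho n^-1], which
    cancels the [n] in [rho h]. *)
Lemma untwist_chi f g h : chi g = chi h -> untwist f g = untwist f h.
Proof.
move=> gh; have nN : (g^-1 * h)%g \in N.
  by rewrite chi_ker chiM -gh -chiM mulVg chi1.
rewrite /untwist -[in RHS](mulKVg g h) (ind_predP _ _ (valP f) _ nN) mulKVg.
by rewrite sigmaE ?groupV // -rhoM invMg invgK mulKVg.
Qed.

Lemma untwist_ind_act h f g :
  untwist (ind_act h f) g = rho h (untwist f (h^-1 * g)%g).
Proof. by rewrite /untwist /= ffunE -rhoM mulKVg. Qed.

Definition fourier (f : ind_space sigma) : {ffun 'I_m -> V} :=
  [ffun s => \sum_i fourier_mx s i *: untwist f (d i)].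

Fact fourier_linear : linear fourier.
Proof.
move=> a u v; apply/ffunP => s; rewrite !ffunE scaler_sumr -big_split /=.
apply: eq_bigr => i _.
by rewrite /untwist /= !ffunE linearP scalerDr !scalerA mulrC.
Qed.

HB.instance Definition _ :=
  GRing.isLinear.Build F (ind_space sigma) {ffun 'I_m -> V} _ fourier
    fourier_linear.

Definition fourier_coef (v : {ffun 'I_m -> V}) (i : 'I_m) : V :=
  \sum_s invmx fourier_mx i s *: v s.

(** Inverse Vandermonde recovers the untwisted value on each class; [rho g^-1] then undoes
    [untwist]. *)
Definition fourier_inv_fun (v : {ffun 'I_m -> V}) : {ffun gT -> V} :=
  [ffun g => rho g^-1%g (fourier_coef v (cls g))].

Fact fourier_inv_ind v : fourier_inv_fun v \in ind_pred sigma.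
Proof.
apply/ind_predP => n nN g; rewrite !ffunE sigmaE ?groupV // -rhoM -invMg.
congr (rho _ (fourier_coef v _)); apply: clsP.
by move: nN; rewrite chi_ker chiM => /eqP ->; rewrite mulr1.
Qed.

Definition fourier_inv v : ind_space sigma := IndSpace (fourier_inv_ind v).

(** Scalar matrices act on families of vectors of [V], so inverting [fourier_mx] over [F] inverts
    the transform on [V]. *)
Lemma mx_action_comp (A B : 'M[F]_m) (v : 'I_m -> V) i :
  \sum_j A i j *: (\sum_l B j l *: v l) = \sum_l (A *m B) i l *: v l.
Proof.
under eq_bigr => j _ do rewrite scaler_sumr.
rewrite exchange_big; apply: eq_bigr => l _; rewrite mxE scaler_suml.
by apply: eq_bigr => j _; rewrite scalerA.
Qed.

Lemma mx_action1 (v : 'I_m -> V) i : \sum_j (1%:M : 'M[F]_m) i j *: v j = v i.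
Proof.
rewrite (bigD1 i) //= big1 => [|j /negPf ji]; rewrite mxE.
  by rewrite eqxx scale1r addr0.
by rewrite eq_sym ji scale0r.
Qed.

Lemma fourierK : cancel fourier fourier_inv.
Proof.
move=> f; apply/val_inj/ffunP => g; rewrite /= ffunE /fourier_coef.
under eq_bigr => s _ do rewrite ffunE.
rewrite mx_action_comp mulVmx ?fourier_mx_unit // mx_action1.
by rewrite (untwist_chi _ (clsK g)) rhoK.
Qed.

Lemma fourier_invK : cancel fourier_inv fourier.
Proof.
move=> v; apply/ffunP => s; rewrite ffunE.
under eq_bigr => i _ do rewrite /untwist /= ffunE rhoVK cls_d.
by rewrite mx_action_comp mulmxV ?fourier_mx_unit // mx_action1.
Qed.

Lemma fourier_equivariant g f :
  fourier (Ind sigma g f) = dsum tau g (fourier f).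
Proof.
apply/ffunP => s; rewrite !ffunE tauE linear_sum scaler_sumr /=.
(* Translation by [g] multiplies the values of [chi] by the nonzero [chi g], hence permutes the
   classes; reindexing along it brings out the factor [chi g ^+ s]. *)
have shift_inj : injective (fun i => cls (g * d i)%g).
  move=> i j eq_ij; apply: chid_inj; apply: (mulfI (chi_neq0 g)).
  by rewrite /= -!chiM -[LHS]clsK eq_ij clsK.
rewrite (reindex_inj shift_inj) /=; apply: eq_bigr => i _.
rewrite untwist_ind_act !fourier_mxE clsK chiM exprMn linearZ scalerA /=.
congr (_ *: rho g _); apply: untwist_chi.
by rewrite chiM clsK -chiM mulKg.
Qed.

Lemma ind_kernel_iso : rep_iso (Ind sigma) (dsum tau).
Proof.
exists fourier; last by move=> g _ f; exact: fourier_equivariant.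
by exists fourier_inv; [exact: fourierK | exact: fourier_invK].
Qed.

End InductionFromKernel.

(** * Representatives of the determinant classes of [GL_2(F_p)] *)

Section GL2.
Variable p : nat.
Hypothesis p_prime : prime p.

Definition diag1_mx (t : 'F_p) : 'M['F_p]_2 :=
  diag_mx (\row_i if i == 0 then t else 1).

Lemma det_diag1_mx t : \det (diag1_mx t) = t.
Proof. by rewrite det_diag !big_ord_recl big_ord0 !mxE /= !mulr1. Qed.

(** The default value [1] is taken only at [t = 0], where the matrix is singular. *)
Definition diag1 (t : 'F_p) : {'GL_2(p)} :=
  insubd (1%g : {'GL_2(p)}) (diag1_mx t).

Lemma det_diag1 t : t != 0 -> \det (GLval (diag1 t)) = t.
Proof.
move=> t0; rewrite -[RHS]det_diag1_mx; congr (\det _).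
by rewrite /diag1 insubdK // -topredE /= [_ \is a _]unitmxE det_diag1_mx unitfE.
Qed.

(** The shift by one skips [0], so the [p - 1] indices match the units. *)
Definition Fp_unit (i : 'I_(p - 1)) : 'F_p := i.+1%:R.

Lemma val_Fp_unit i : Fp_unit i = i.+1 :> nat.
Proof.
by rewrite val_Fp_nat // modn_small // -ltn_predRL -subn1 ltn_ord.
Qed.

Lemma Fp_unit_neq0 i : Fp_unit i != 0.
Proof. by rewrite -val_eqE /= val_Fp_unit. Qed.

Lemma Fp_unit_inj : injective Fp_unit.
Proof.
move=> i j /(congr1 (nat_of_ord (n := _))); rewrite !val_Fp_unit.
by case=> /val_inj.
Qed.

Lemma Fp_unit_surj (t : 'F_p) : t != 0 -> {i | Fp_unit i = t}.
Proof.
rewrite -val_eqE /= -lt0n => t0.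
have tp : (t < p)%N by rewrite -{2}(Fp_cast p_prime).
have ti : (t.-1 < p - 1)%N by rewrite subn1 ltn_predRL prednK.
by exists (Ordinal ti); apply/val_inj; rewrite /= val_Fp_unit /= prednK.
Qed.

Definition det_class (g : {'GL_2(p)}) : 'I_(p - 1) :=
  sval (Fp_unit_surj (GL_det g)).

Lemma det_classK g :
  \det (GLval (diag1 (Fp_unit (det_class g)))) = \det (GLval g).
Proof.
by rewrite det_diag1 ?Fp_unit_neq0 // /det_class; case: Fp_unit_surj.
Qed.

End GL2.

(** * The polynomial representations and their determinant twists *)

Section GL2Representations.
Variables (p : nat) (F : fieldType) (iota : {rmorphism 'F_p -> F}) (k : nat).

(** The extension of [Pol] to the whole group whose twists by powers of the determinant are the
    [PolDet]. *)
Definition PolGL : rep [set: {'GL_2(p)}]%G (dhomog 2 F k) :=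
  @Rep F _ [set: {'GL_2(p)}]%G (dhomog 2 F k) (fun g => @pol_subst p F iota k g)
    (@pol_subst1 p F iota k) (fun g h _ _ => @pol_substM p F iota k g h).

Lemma Ind_Pol_iso : prime p ->
  rep_iso (Ind (Pol iota k))
          (dsum (fun s : 'I_(p - 1) => PolDet iota k (s : nat)%:Z)).
Proof.
move=> p_prime.
apply: (@ind_kernel_iso _ _ _ _ PolGL _ _ (fun g => iota (\det (GLval g))) _ _ _
  (fun i => diag1 (Fp_unit i)) (det_class p_prime)) => //.
- by move=> g h; rewrite GL_ME det_mulmx rmorphM.
(* Since [iota] is injective, the kernel of [iota] after the determinant is exactly [SL2 p]. *)
- by move=> g; rewrite inE fmorph_eq1.
- by move=> g; rewrite det_classK.
move=> i j /= /fmorph_inj; rewrite !det_diag1 ?Fp_unit_neq0 //.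
exact: Fp_unit_inj.
Qed.

Lemma PolDet_SL2 r n (P : dhomog 2 F k) :
  n \in SL2 p -> PolDet iota k r n P = Pol iota k n P.
Proof.
by rewrite inE /= /pold_act => /eqP ->; rewrite rmorph1 exp1rz scale1r.
Qed.

End GL2Representations.

Theorem mainTheorem4 (p : nat) (p_prime : prime p)
    (F : closedFieldType) (iota : {rmorphism 'F_p -> F})
    (F_algebraic : forall z : F, algebraicOver iota z)
    (k r : nat) (hk : (k <= p - 1)%N) (hr : (r <= p - 2)%N) :
  [/\ rep_iso (Res (subsetT (SL2 p)) (Ind (Pol iota k)))
              (copies (p - 1) (Pol iota k)),
      rep_iso (Res (subsetT (SL2 p)) (PolDet iota k r%:Z)) (Pol iota k)
    & rep_iso (Ind (Pol iota k))
              (dsum (fun s : 'I_(p - 1) => PolDet iota k (s : nat)%:Z))].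
Proof.
have ind_iso := Ind_Pol_iso iota k p_prime.
split=> //.
  (* The isomorphism over the whole group also serves over [SL2 p], where every determinant twist is
     trivial. *)
  case: ind_iso => phi phi_bij phiE; exists phi => // n nN f.
  rewrite [LHS]phiE ?inE //; apply/ffunP => s.
  by rewrite !ffunE PolDet_SL2.
exists idfun; first by exists idfun.
by move=> n nN P; exact: PolDet_SL2.
Qed.
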